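(* Let $0<a\le b$ and let $\mathcal{T}_{a,b}$ be the right-angled triangle with vertices $(0,b)$, $(a,0)$, $(0,0)$. Put $c=\sqrt{a^2+b^2}$, $\alpha=\arctan(a/b)$, $u=a+b+c$, $h=a\cos\alpha$. Then the chord length distribution function $F$ of $\mathcal{T}_{a,b}$ is given by $$F(s)=\begin{cases}0 & \text{if } s<0,\\ H_1(s)/u & \text{if } 0\le s<h,\\ H_2(s)/u & \text{if } h\le s<a,\\ H_3(s)/u & \text{if } a\le s<b,\\ H_4(s)/u & \text{if } b\le s<c,\\ 1 & \text{if } s\ge c,\end{cases}$$ where $$H_1(s)=\frac{\Theta_1 s}{4},$$ $$H_2(s)=\frac{\Theta_2 s}{4}+\Theta_3L_1(s,h)+c\,L_2(s,h),$$ $$H_3(s)=a+\Theta_4 s+\frac{\Theta_3}{2}L_1(s,h)+\frac{c}{2}L_2(s,h)+\frac{b}{2a}L_1(s,a)+\frac{b}{2}L_2(s,a),$$ $$H_4(s)=\Theta_5+\frac{\Theta_6 s}{4}+\frac{b}{2a}L_1(s,a)+\frac{b}{2}L_2(s,a)+\frac{a}{2b}L_1(s,b)+\frac{a}{2}L_2(s,b)$$ with $$\Theta_1=\frac ab(2\alpha+\pi)+\frac{2b}{a}(\pi-\alpha)+6,\quad \Theta_2=\frac ab(2\alpha-\pi)-\frac{2b}{a}\alpha+6,\quad \Theta_3=\frac ab+\frac ba,$$ $$\Theta_4=1-\frac ba\alpha,\quad \Theta_5=a+b,\quad \Theta_6=\frac ab(2\alpha-\pi)-\frac{2b}{a}\alpha+2$$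 and, for $s\ge x>0$, $$L_1(s,x)=s\arcsin\frac xs,\qquad L_2(s,x)=\sqrt{1-\left(\frac xs\right)^2}.$$
   Context: A line in the plane is written $g=g(p,\psi)=\{(x,y)\in\mathbb{R}^2: x\cos\psi+y\sin\psi=p\}$ with $0\le p<\infty$, $0\le\psi<2\pi$. The measure $\mu$ of a set of lines is the integral of $\mathrm{d}p\,\mathrm{d}\psi$ over the corresponding set of parameters $(p,\psi)$. The triangle $\mathcal{T}_{a,b}$ is understood as the closed convex set (with interior); $u$ is its perimeter, $c$ its hypotenuse, and $h$ its height over the hypotenuse. For a line $g$ put $\chi(g)=g\cap\mathcal{T}_{a,b}$ (the chord produced by $g$) and let $|\chi(g)|$ be its length. The chord length distribution function of $\mathcal{T}_{a,b}$ is $$F(s)=\frac1u\,\mu\bigl(\{g:\ g\cap\mathcal{T}_{a,b}\neq\emptyset,\ |\chi(g)|\le s\}\bigr).$$ *)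

(* Defs.v *)
From HB Require Import structures.
From mathcomp Require Import all_boot all_order all_algebra.
From mathcomp Require Import all_classical all_reals all_analysis.
From mathcomp Require Import ring.

Set Implicit Arguments.
Unset Strict Implicit.
Unset Printing Implicit Defensive.

Import Order.TTheory GRing.Theory Num.Theory.

Local Open Scope classical_set_scope.
Local Open Scope ring_scope.

Section Lines.
Context {R : realType}.
Implicit Types (p psi t s : R) (K : set (R * R)).

Definition line p psi : set (R * R) :=
  [set q | q.1 * cos psi + q.2 * sin psi = p].

(* Arc-length parametrization of [line p psi], starting at the foot of the
   perpendicular from the origin: see [range_line_pt] and [line_pt_dist]. *)
Definition line_pt p psi t : R * R :=
  (p * cos psi - t * sin psi, p * sin psi + t * cos psi).

Lemma range_line_pt p psi : range (line_pt p psi) = line p psi.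
Proof.
have cs := cos2Dsin2 psi; rewrite /line; apply/seteqP; split.
- move=> _ [t _ <-] /=; rewrite -[RHS]mulr1 -cs; ring.
- move=> [x y] /= <-; exists (y * cos psi - x * sin psi) => //.
  rewrite /line_pt; congr pair.
  + rewrite -[RHS]mulr1 -cs; ring.
  + rewrite -[RHS]mulr1 -cs; ring.
Qed.

Lemma line_pt_dist p psi t t' :
  Num.sqrt (((line_pt p psi t).1 - (line_pt p psi t').1) ^+ 2 +
            ((line_pt p psi t).2 - (line_pt p psi t').2) ^+ 2) = `|t - t'|.
Proof.
rewrite -sqrtr_sqr; congr Num.sqrt => /=.
rewrite -[RHS]mulr1 -(cos2Dsin2 psi); ring.
Qed.

Definition chord K p psi : set (R * R) := line p psi `&` K.

(* Length = one-dimensional Lebesgue measure along the line. *)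
Definition chord_length K p psi : \bar R :=
  lebesgue_measure (line_pt p psi @^-1` chord K p psi).

(* A set of lines is given by the predicate [G p psi] on its parameters. *)
Definition line_params (G : R -> R -> Prop) : set (R * R) :=
  [set z | [/\ 0 <= z.1, 0 <= z.2 < 2 * pi & G z.1 z.2]].

(* The integral of dp dpsi over the parameters of the lines in [G]. *)
Definition lines_measure (G : R -> R -> Prop) : \bar R :=
  (\int[(@lebesgue_measure R \x @lebesgue_measure R)]_(z in line_params G) 1)%E.

(* Closed solid triangle, as the convex hull of its vertices. *)
Definition triangle (A B C : R * R) : set (R * R) :=
  [set q | exists l m n : R, [/\ 0 <= l, 0 <= m, 0 <= n, l + m + n = 1 &
    q = (l * A.1 + m * B.1 + n * C.1, l * A.2 + m * B.2 + n * C.2)]].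

End Lines.

Section RightTriangle.
Context {R : realType}.
Variables a b : R.

Definition right_triangle : set (R * R) := triangle (0, b) (a, 0) (0, 0).

Definition hyp_c : R := Num.sqrt (a ^+ 2 + b ^+ 2).
Definition angle_alpha : R := atan (a / b).
Definition perimeter_u : R := a + b + hyp_c.
Definition height_h : R := a * cos angle_alpha.

Definition chord_cdf (s : R) : \bar R :=
  ((perimeter_u^-1)%:E *
   lines_measure (fun p psi => chord right_triangle p psi !=set0 /\
                               (chord_length right_triangle p psi <= s%:E)%E))%E.

Local Notation alpha := angle_alpha.
Local Notation c := hyp_c.
Local Notation h := height_h.

Definition Theta1 : R :=
  a / b * (2 * alpha + pi) + 2 * b / a * (pi - alpha) + 6.
Definition Theta2 : R :=
  a / b * (2 * alpha - pi) - 2 * b / a * alpha + 6.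
Definition Theta3 : R := a / b + b / a.
Definition Theta4 : R := 1 - b / a * alpha.
Definition Theta5 : R := a + b.
Definition Theta6 : R :=
  a / b * (2 * alpha - pi) - 2 * b / a * alpha + 2.

Definition L1 (s x : R) : R := s * asin (x / s).
Definition L2 (s x : R) : R := Num.sqrt (1 - (x / s) ^+ 2).

Definition H1 (s : R) : R := Theta1 * s / 4.
Definition H2 (s : R) : R := Theta2 * s / 4 + Theta3 * L1 s h + c * L2 s h.
Definition H3 (s : R) : R :=
  a + Theta4 * s + Theta3 / 2 * L1 s h + c / 2 * L2 s h
  + b / (2 * a) * L1 s a + b / 2 * L2 s a.
Definition H4 (s : R) : R :=
  Theta5 + Theta6 * s / 4 + b / (2 * a) * L1 s a + b / 2 * L2 s a
  + a / (2 * b) * L1 s b + a / 2 * L2 s b.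

End RightTriangle.

(* Main.v *)
(* Fix the direction psi of the normal.  As p varies, the chord length is a tent
   function on an interval of length w(psi), the width of the triangle, and its
   maximum m satisfies m * w(psi) = a * b, twice the area.  Hence the chords of
   length at most s have p-measure w * min(1, s * w / (a * b)).  Since lines are
   parametrized with p >= 0, a single psi only sees the part [0, P(psi)] of this
   interval, where P is the support function; as one vertex is the origin, that
   part contributes P * min(1, s * w / (a * b)), and psi and psi + pi together
   restore the full width w(psi) = P(psi) + P(psi + pi).  On [0, pi] the width is
   a cos psi, then b sin psi, then c sin (psi - alpha), so the measure is a sum of
   four integrals of min(r cos t, s (r cos t)^2 / (a * b)): over [0, alpha] for
   r = a, c and over [0, pi / 2 - alpha] for r = b, c. *)
Require Import Defs.
From mathcomp Require Import all_boot all_order all_algebra.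
From mathcomp Require Import all_classical all_reals all_analysis.
From mathcomp Require Import measurable_realfun.
From mathcomp Require Import ring lra.

Set Implicit Arguments.
Unset Strict Implicit.
Unset Printing Implicit Defensive.

Import Order.TTheory GRing.Theory Num.Theory.
Import numFieldNormedType.Exports.

Local Open Scope classical_set_scope.
Local Open Scope ring_scope.

(** * Chord length of a general triangle, seen from a vertex cut off by the line *)

Section ChordLength.
Context {R : realType}.
Implicit Types (p psi s t : R) (V : R * R).

Lemma lebesgue_measure_segment (x y : R) :
  lebesgue_measure [set t : R | exists2 k, 0 <= k <= 1 & t = k * x + (1 - k) * y]
  = `|x - y|%:E.
Proof.
wlog xy : x y / x <= y => [hw|].
  have [|/ltW yx] := leP x y; first exact: hw.
  rewrite distrC -hw//; congr lebesgue_measure; apply/seteqP.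
  by split => t [k k01 ->]; exists (1 - k); [lra|ring|lra|ring].
rewrite (_ : [set _ | _] = `[x, y]%classic).
  rewrite lebesgue_measure_itv/= lte_fin distrC ger0_norm ?subr_ge0//.
  by case: ltP => // yx; rewrite (@le_anti _ _ x y) ?xy// subrr.
apply/seteqP; split => t; rewrite /= in_itv/=.
  by move=> [k k01 ->]; apply/andP; split; nra.
move=> /andP[xt ty]; have [xy0|nxy] := eqVneq x y.
  by exists 0; rewrite ?lexx ?ler01//; lra.
have d0 : 0 < y - x by rewrite subr_gt0 lt_neqAle nxy.
exists ((y - t) / (y - x)).
  by rewrite divr_ge0 ?ler_pdivrMr//; lra.
by field; rewrite gt_eqF.
Qed.

(** Section of a triangle with an apex at the origin: [d1], [d2] are the coordinates of the other
    vertices across the line and [e1], [e2] those along it. The hypotheses say that the line at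
    level [x] crosses both sides at the apex, at the fractions [x / d1] and [x / d2]; the section is
    the segment between the two crossing points. The levels may all be negative. *)
Lemma lebesgue_measure_cone (d1 d2 e1 e2 x t0 : R) :
  0 < x / d1 <= 1 -> 0 < x / d2 <= 1 ->
  lebesgue_measure [set t | exists m n : R,
    [/\ 0 <= m, 0 <= n, m + n <= 1, m * d1 + n * d2 = x &
        m * e1 + n * e2 = t - t0]] = `|x * (e1 / d1 - e2 / d2)|%:E.
Proof.
move=> /andP[l0 l1] /andP[k0 k1].
(* Since division by 0 gives 0, positivity of the quotients excludes zero numerators and
   denominators. *)
have x0 : x != 0 by apply: contraTneq l0 => ->; rewrite mul0r ltxx.
have d10 : d1 != 0 by apply: contraTneq l0 => ->; rewrite invr0 mulr0 ltxx.
have d20 : d2 != 0 by apply: contraTneq k0 => ->; rewrite invr0 mulr0 ltxx.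
have -> : x * (e1 / d1 - e2 / d2) =
  (t0 + x * e1 / d1) - (t0 + x * e2 / d2) by ring.
rewrite -lebesgue_measure_segment; congr lebesgue_measure.
apply/seteqP; split => t /=.
  move=> [m [n [m0 n0 mn mnx mnt]]].
  have kE : m * (d1 / x) + n * (d2 / x) = 1 by rewrite -(divff x0) -mnx; ring.
  have D1 : 0 < d1 / x by rewrite -invf_div invr_gt0.
  have D2 : 0 < d2 / x by rewrite -invf_div invr_gt0.
  have M0 := mulr_ge0 m0 (ltW D1); have N0 := mulr_ge0 n0 (ltW D2).
  (* The weights of the two crossing points are [m] and [n] divided by the crossing fractions; by
     [kE] they sum to 1. *)
  exists (m * (d1 / x)); first lra.
  have -> : 1 - m * (d1 / x) = n * (d2 / x) by lra.
  rewrite -(subrK t0 t) -mnt.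
  transitivity (t0 * (m * (d1 / x) + n * (d2 / x)) + (m * e1 + n * e2)).
    by rewrite kE; ring.
  by field; rewrite x0 d10 d20.
move=> [k /andP[kk0 kk1] ->]; exists (k * (x / d1)), ((1 - k) * (x / d2)).
split; [by nra|by nra|by nra| |].
- by field; rewrite d10 d20.
- by field; rewrite d10 d20.
Qed.

(** The signed level [p] of the line through [V] with normal angle [psi]. *)
Definition proj psi V : R := V.1 * cos psi + V.2 * sin psi.

Lemma proj_line_pt p psi t : proj psi (line_pt p psi t) = p.
Proof. by rewrite /proj/= -[RHS]mulr1 -(cos2Dsin2 psi); ring. Qed.

Lemma chord_preimage (K : set (R * R)) p psi :
  line_pt p psi @^-1` chord K p psi = line_pt p psi @^-1` K.
Proof.
apply/seteqP; split => t /=; first by case.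
by move=> Kt; split => //; exact: proj_line_pt.
Qed.

(** In the frame rotated by [psi], with apex [V], this is [lebesgue_measure_cone]. The determinant
    is twice the signed area of the triangle, which the rotation preserves. *)
Lemma chord_length_apex V V1 V2 p psi :
  let x := p - proj psi V in
  let d1 := proj psi V1 - proj psi V in let d2 := proj psi V2 - proj psi V in
  0 < x / d1 <= 1 -> 0 < x / d2 <= 1 ->
  chord_length (triangle V V1 V2) p psi =
  `|x * ((V1.1 - V.1) * (V2.2 - V.2) - (V1.2 - V.2) * (V2.1 - V.1)) / (d1 * d2)|%:E.
Proof.
move=> x d1 d2 xd1 xd2; rewrite /chord_length chord_preimage.
(* Coordinate along the line, completing [proj psi] to a rotated frame. *)
pose ort W : R := W.2 * cos psi - W.1 * sin psi.
have d10 : d1 != 0.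
  by apply: contraTneq xd1 => ->; rewrite invr0 mulr0 ltxx.
have d20 : d2 != 0.
  by apply: contraTneq xd2 => ->; rewrite invr0 mulr0 ltxx.
have cs := cos2Dsin2 psi.
transitivity (lebesgue_measure [set t | exists m n : R,
    [/\ 0 <= m, 0 <= n, m + n <= 1, m * d1 + n * d2 = x &
        m * (ort V1 - ort V) + n * (ort V2 - ort V) = t - ort V]]).
  congr lebesgue_measure; apply/seteqP; split => t /=.
    move=> [l [m [n [l0 m0 n0 lmn [E1 E2]]]]]; exists m, n.
    have lE : l = 1 - m - n by lra.
    split=> //; first lra.
    - rewrite /x -(proj_line_pt p psi t) /d1 /d2 /proj/= E1 E2 lE; ring.
    - rewrite -[t in RHS]mulr1 -cs.
      transitivity (((p * sin psi + t * cos psi) * cos psi -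
         (p * cos psi - t * sin psi) * sin psi) - ort V); last by ring.
      rewrite E1 E2 lE /ort; ring.
  move=> [m [n [m0 n0 mn mnx mnt]]]; exists (1 - m - n), m, n.
  have pE : p = (1 - m - n) * proj psi V + m * proj psi V1 + n * proj psi V2.
    by move: mnx; rewrite /x /d1 /d2; lra.
  have tE : t = (1 - m - n) * ort V + m * ort V1 + n * ort V2 by lra.
  split=> //; [lra|lra|rewrite /line_pt pE tE /proj /ort; congr pair].
  - transitivity (((1 - m - n) * V.1 + m * V1.1 + n * V2.1) *
      (cos psi ^+ 2 + sin psi ^+ 2)); last by rewrite cs mulr1.
    ring.
  - transitivity (((1 - m - n) * V.2 + m * V1.2 + n * V2.2) *
      (cos psi ^+ 2 + sin psi ^+ 2)); last by rewrite cs mulr1.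
    ring.
rewrite lebesgue_measure_cone// -normrN; congr (`|_|%:E).
transitivity (x * ((ort V2 - ort V) * d1 - (ort V1 - ort V) * d2) / (d1 * d2)).
  by field; rewrite ?d10 ?d20.
congr (_ * _ / _); rewrite -[RHS]mulr1 -cs /d1 /d2 /ort /proj; ring.
Qed.

Lemma triangle_rot V V1 V2 : triangle V V1 V2 = triangle V1 V2 V.
Proof.
apply/seteqP; split => q [l [m [n [l0 m0 n0 lmn ->]]]].
- by exists m, n, l; split=> //; [lra|congr pair; ring].
- by exists n, l, m; split=> //; [lra|congr pair; ring].
Qed.

End ChordLength.

(** * Short chords in a fixed direction *)

Section LevelSets.
Context {R : realType}.
Implicit Types (A : set R).

(* Up to [0] and [P], [A] is the [s]-sublevel set of the tent of height [m]
   peaking at [q]; the rising side is absent for [q = 0] and the falling one for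
   [q = P], so neither division by zero is reached. *)
Lemma lebesgue_measure_tent A (P q m s : R) : 0 <= q <= P -> 0 < m -> 0 <= s ->
  measurable A -> A `<=` `[0, P] ->
  (forall p : R, 0 < p < P -> p <= q -> A p <-> p * m / q <= s) ->
  (forall p : R, 0 < p < P -> q <= p -> A p <-> (P - p) * m / (P - q) <= s) ->
  lebesgue_measure A = (P * Num.min 1 (s / m))%:E.
Proof.
move=> /andP[q0 qP] m0 s0 mA AP Aq AQ.
have P0 : 0 <= P by lra.
(* Nothing is assumed about membership of 0 and [P] in [A]; these two points form a null set. *)
have sandwich (U : set R) v : measurable U -> U `<=` A ->
    A `<=` U `|` ([set 0] `|` [set P]) -> lebesgue_measure U = v ->
    lebesgue_measure A = v.
  move=> mU UA AU Uv; apply/eqP; rewrite eq_le; apply/andP; split; last first.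
    by rewrite -Uv; apply: le_measure => //; rewrite inE.
  have m01 : measurable ([set 0] `|` [set P] : set R) by apply: measurableU.
  have null01 : lebesgue_measure ([set 0] `|` [set P] : set R) = 0%E.
    by apply: null_set_setU => //; exact: lebesgue_measure_set1.
  rewrite -Uv -(@measureU0 _ _ _ lebesgue_measure _ _ mU m01 null01).
  by apply: le_measure => //; rewrite inE//; exact: measurableU.
have [ms|sm] := leP m s.
  have -> : Num.min 1 (s / m) = 1.
    by apply/min_idPl; rewrite ler_pdivlMr// mul1r.
  apply: (sandwich `]0, P[%classic) => //.
  - move=> p; rewrite /= in_itv/= => p0P; have /andP[p0 pP] := p0P.
    have [pq|/ltW qp] := leP p q.
      by apply/(Aq _ p0P pq); rewrite ler_pdivrMr; nra.
    by apply/(AQ _ p0P qp); rewrite ler_pdivrMr; nra.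
  - move=> p /AP/=; rewrite !in_itv/= => /andP[].
    rewrite le_eqVlt => /predU1P[<- _|p0]; first by right; left.
    rewrite le_eqVlt => /predU1P[->|pP]; first by right; right.
    by left; rewrite p0.
  - rewrite mulr1 lebesgue_measure_itv/= lte_fin sube0.
    by case: ltP => // ?; congr _%:E; lra.
have g1 : s / m < 1 by rewrite ltr_pdivrMr// mul1r.
have g0 : 0 <= s / m by rewrite divr_ge0// ltW.
have sE : s = s / m * m by rewrite divfK// gt_eqF.
rewrite min_r ?ltW//; set g := s / m in g0 g1 sE *.
(* Below the peak, each side of the tent contributes the fraction [g = s / m] of its base, measured
   from its foot. For [q = 0] or [q = P] one interval is empty. *)
apply: (sandwich (`]0%R, (q * g)] `|` `[(P - (P - q) * g)%R, P[)%classic).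
- exact: measurableU.
- move=> p /= []; rewrite in_itv/= => /andP[].
  + move=> p0 pg; have qp : p < q by nra.
    by apply/Aq; [lra|lra|rewrite ler_pdivrMr; nra].
  + move=> pg pP; have qP' : q < P by nra.
    by apply/AQ; [nra|nra|rewrite ler_pdivrMr; nra].
- move=> p Ap; have := AP _ Ap; rewrite /= !in_itv/= => /andP[].
  rewrite le_eqVlt => /predU1P[<- _|p0]; first by right; left.
  rewrite le_eqVlt => /predU1P[->|pP]; first by right; right.
  have p0P : 0 < p < P by rewrite p0.
  left; have [pq|qp] := leP p q; [left|right].
    have q0' : 0 < q by lra.
    move/(Aq _ p0P pq): Ap; rewrite p0 ler_pdivrMr// => h /=; nra.
  have q0' : 0 < P - q by lra.
  move/(AQ _ p0P (ltW qp)): Ap; rewrite pP andbT ler_pdivrMr// => h; nra.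
- rewrite measureU//=.
    rewrite !lebesgue_measure_itv/= !lte_fin.
    have -> : (if 0 < q * g then ((q * g)%:E - 0%:E)%E else 0%E) = (q * g)%:E.
      by case: ltP => [_|?]; [rewrite sube0|congr _%:E; nra].
    have -> : (if P - (P - q) * g < P then
        (P%:E - (P - (P - q) * g)%:E)%E else 0%E) = ((P - q) * g)%:E.
      by case: ltP => [_|?]; [rewrite -EFinB|]; congr _%:E; [ring|nra].
    by rewrite -EFinD; congr _%:E; ring.
  rewrite -subset0 => p [] /=; rewrite !in_itv/= => /andP[p0 pq] /andP[pq' pP].
  by have := mulr_ge0 q0 g0; nra.
Qed.
End LevelSets.

(** * Support function, width and chord length profile of the right triangle *)

Section RightTriangleChords.
Context {R : realType}.
Variables a b : R.
Hypotheses (a0 : 0 < a) (b0 : 0 < b).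

Lemma right_triangleE : right_triangle a b =
  [set q | [/\ 0 <= q.1, 0 <= q.2 & b * q.1 + a * q.2 <= a * b]].
Proof.
have ab0 := mulr_gt0 a0 b0; apply/seteqP; split => q.
  move=> [l [m [n [l0 m0 n0 lmn ->]]]] /=; rewrite !mulr0 !addr0 add0r.
  split; [by rewrite mulr_ge0// ltW..|].
  have -> : b * (m * a) + a * (l * b) = a * b * (1 - n) by rewrite -lmn; ring.
  by rewrite ler_piMr ?(ltW ab0)//; lra.
move=> [q10 q20 qab].
exists (q.2 / b), (q.1 / a), (1 - q.2 / b - q.1 / a); split.
- by rewrite divr_ge0// ltW.
- by rewrite divr_ge0// ltW.
- rewrite (_ : _ - _ = (a * b - (b * q.1 + a * q.2)) / (a * b)).
    by rewrite divr_ge0 ?subr_ge0// ltW.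
  by field; rewrite !gt_eqF.
- ring.
- case: q {q10 q20 qab} => x y /=.
  by rewrite !mulr0 !add0r !addr0 !divfK ?gt_eqF.
Qed.

(** The maximum of [proj psi] over the vertices; the 0 comes from the vertex at the origin. *)
Definition support psi : R := Num.max 0 (Num.max (a * cos psi) (b * sin psi)).

Definition width psi : R := support psi + support (psi + pi).

Lemma support_ge0 psi : 0 <= support psi.
Proof. by rewrite le_max lexx. Qed.

Lemma support_ge_cos psi : a * cos psi <= support psi.
Proof. by rewrite /support !le_max lexx orbT. Qed.

Lemma support_ge_sin psi : b * sin psi <= support psi.
Proof. by rewrite /support !le_max lexx !orbT. Qed.

Lemma supportP psi : [\/ support psi = 0, support psi = a * cos psi |
  support psi = b * sin psi].
Proof.
rewrite /support; case: (leP (a * cos psi) (b * sin psi)) => _; case: leP => _;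
  by [apply: Or31|apply: Or32|apply: Or33].
Qed.

Lemma width_gt0 psi : 0 < width psi.
Proof.
have h1 := support_ge_cos psi; have h2 := support_ge_sin psi.
have h3 := support_ge_cos (psi + pi); have h4 := support_ge_sin (psi + pi).
have h5 := support_ge0 psi; have h6 := support_ge0 (psi + pi).
rewrite cosDpi sinDpi in h3 h4.
have cs := cos2Dsin2 psi.
rewrite ltNge; apply/negP; rewrite /width => w0.
have C0 : cos psi = 0.
  have /eqP : a * cos psi = 0 by lra.
  by rewrite mulf_eq0 gt_eqF// => /eqP.
have S0 : sin psi = 0.
  have /eqP : b * sin psi = 0 by lra.
  by rewrite mulf_eq0 gt_eqF// => /eqP.
by move: cs; rewrite C0 S0; lra.
Qed.

(** A point of the triangle is a convex combination of the vertices, so its level is at most the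
    support. Conversely, the vertex attaining the support is shrunk towards the origin, itself a
    vertex, until its level is [p]. *)
Lemma chord_neq0 p psi : 0 <= p ->
  chord (right_triangle a b) p psi !=set0 <-> p <= support psi.
Proof.
move=> p0; rewrite right_triangleE; split.
  move=> [[x y] [/= <- [/= x0 y0 xy]]].
  have ab0 := mulr_gt0 a0 b0.
  rewrite -(ler_pM2l ab0).
  apply: (@le_trans _ _ ((b * x + a * y) * support psi)); last first.
    by apply: ler_wpM2r => //; exact: support_ge0.
  have /(ler_wpM2l (mulr_ge0 (ltW b0) x0)) := support_ge_cos psi.
  have /(ler_wpM2l (mulr_ge0 (ltW a0) y0)) := support_ge_sin psi.
  by move=> h1 h2; apply: (le_trans _ (le_trans (lerD h1 h2) _)); lra.
have on_edge (V : R * R) : V.1 * cos psi + V.2 * sin psi = support psi ->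
    [/\ 0 <= V.1, 0 <= V.2 & b * V.1 + a * V.2 <= a * b] ->
    p <= support psi ->
    chord [set q | [/\ 0 <= q.1, 0 <= q.2 & b * q.1 + a * q.2 <= a * b]] p psi
      !=set0.
  (* If the support is 0, then [p = 0] too, and division by 0 gives the correct factor [k = 0]. *)
  move=> VE [V1 V2 V12] pP; pose k := p / support psi.
  have [k0 k1] : 0 <= k /\ k <= 1.
    rewrite /k; split; first by rewrite divr_ge0 ?support_ge0.
    have := support_ge0 psi; rewrite le_eqVlt => /predU1P[<-|P0].
      by rewrite invr0 mulr0 ler01.
    by rewrite ler_pdivrMr// mul1r.
  have kE : k * support psi = p.
    have [P0|P0] := eqVneq (support psi) 0; last by rewrite /k divfK.
    by rewrite /k P0 mulr0; move: pP; rewrite P0; lra.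
  exists (k * V.1, k * V.2); split; first by rewrite /line/= -kE -VE; ring.
  split; [exact: mulr_ge0|exact: mulr_ge0|rewrite /=].
  have -> : b * (k * V.1) + a * (k * V.2) = k * (b * V.1 + a * V.2) by ring.
  by apply: (le_trans _ V12); rewrite ler_piMl// addr_ge0//;
    rewrite mulr_ge0 ?(ltW a0) ?(ltW b0).
case: (supportP psi) => P_; apply: on_edge.
- by instantiate (1 := (0, 0)); rewrite P_ !mul0r addr0.
- by rewrite /= !mulr0 addr0; split => //; rewrite mulr_ge0 ?ltW.
- by instantiate (1 := (a, 0)); rewrite P_ !mul0r addr0.
- by rewrite /= mulr0 addr0; split => //; [exact: ltW|rewrite mulrC].
- by instantiate (1 := (0, b)); rewrite P_ !mul0r add0r.
- by rewrite /= mulr0 add0r; split => //; exact: ltW.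
Qed.

(** The peak [q] is the level of the middle vertex, or 0 if the support is 0. On each side of it the
    line cuts off one vertex and [chord_length_apex] gives a linear function. The peak height is
    [a * b / width psi], because the longest chord times the width is twice the area. *)
Lemma chord_length_profile psi :
  exists2 q, 0 <= q <= support psi &
  forall p : R, 0 < p < support psi ->
    (p <= q -> chord_length (right_triangle a b) p psi =
       (p * (a * b / width psi) / q)%:E) /\
    (q <= p -> chord_length (right_triangle a b) p psi =
       ((support psi - p) * (a * b / width psi) / (support psi - q))%:E).
Proof.
have ab0 := mulr_gt0 a0 b0.
pose C := a * cos psi; pose S := b * sin psi.
have projO : proj psi (0, 0) = 0 by rewrite /proj/=; ring.
have projA : proj psi (a, 0) = C by rewrite /proj/= /C; ring.
have projB : proj psi (0, b) = S by rewrite /proj/= /S; ring.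
(* One formula for each vertex that the line can cut off. *)
have fromO p : 0 < p / S <= 1 -> 0 < p / C <= 1 ->
    chord_length (right_triangle a b) p psi = `|p * (a * b) / (S * C)|%:E.
  move=> h1 h2; rewrite /right_triangle 2!triangle_rot.
  have := @chord_length_apex _ (0, 0) (0, b) (a, 0) p psi.
  rewrite projO projA projB !subr0/= => ->//.
  by rewrite -normrN; congr (`|_|%:E); ring.
have fromA p : 0 < (p - C) / - C <= 1 -> 0 < (p - C) / (S - C) <= 1 ->
    chord_length (right_triangle a b) p psi =
    `|(C - p) * (a * b) / (- C * (S - C))|%:E.
  move=> h1 h2; rewrite /right_triangle triangle_rot.
  have := @chord_length_apex _ (a, 0) (0, 0) (0, b) p psi.
  rewrite projO projA projB sub0r/= => ->//.
  by congr (`|_|%:E); ring.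
have fromB p : 0 < (p - S) / (C - S) <= 1 -> 0 < (p - S) / - S <= 1 ->
    chord_length (right_triangle a b) p psi =
    `|(S - p) * (a * b) / ((C - S) * - S)|%:E.
  move=> h1 h2; rewrite /right_triangle.
  have := @chord_length_apex _ (0, b) (a, 0) (0, 0) p psi.
  rewrite projO projA projB sub0r/= => ->//.
  by congr (`|_|%:E); ring.
have PE : support psi = Num.max 0 (Num.max C S) by [].
have wE : width psi = support psi + Num.max 0 (Num.max (- C) (- S)).
  by rewrite /width {2}/support cosDpi sinDpi !mulrN.
clearbody C S; have ratio (x y : R) : 0 < x -> x <= y -> 0 < x / y <= 1.
  by move=> x0 xy; rewrite divr_gt0 ?ler_pdivrMr; lra.
have ratioN (x y : R) : x < 0 -> y <= x -> 0 < x / y <= 1.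
  by move=> x0 xy; rewrite -divrNN; apply: ratio; lra.
have normE (x y z : R) : 0 < x -> 0 < y -> 0 < z ->
    `|x * (a * b / y) / z| = x * (a * b / y) / z.
  by move=> x0 y0 z0; rewrite gtr0_norm// divr_gt0// mulr_gt0// divr_gt0.
(* If neither [C] nor [S] is positive, the support is 0 and no [p] is left. If exactly one is, the
   origin is the middle vertex: the peak is at 0 and only the falling side is seen. *)
have [C0|C0] := leP C 0; have [S0|S0] := leP S 0.
- have P0 : support psi = 0 by rewrite PE; apply/max_idPl; rewrite ge_max C0.
  by exists 0; rewrite P0 ?lexx// => p /andP[/lt_trans h /h]; rewrite ltxx.
- have P_ : support psi = S.
    by rewrite PE (max_r (le_trans C0 (ltW S0))) max_r// ltW.
  have w_ : width psi = S - C.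
    by rewrite wE P_ (@max_l _ _ (- C)) ?max_r; lra.
  exists 0; rewrite P_ ?lexx ?(ltW S0)// w_ => p /andP[p0 pS].
  split=> [/le_lt_trans/(_ p0)|_]; first by rewrite ltxx.
  rewrite fromB; [|apply: ratioN; lra..].
  rewrite subr0 (_ : _ / _ = (S - p) * (a * b / (S - C)) / S).
    by rewrite normE//; lra.
  by field; apply/and3P; split; lra.
- have P_ : support psi = C.
    by rewrite PE (max_l (le_trans S0 (ltW C0))) max_r// ltW.
  have w_ : width psi = C - S.
    by rewrite wE P_ (@max_r _ _ (- C)) ?max_r; lra.
  exists 0; rewrite P_ ?lexx ?(ltW C0)// w_ => p /andP[p0 pS].
  split=> [/le_lt_trans/(_ p0)|_]; first by rewrite ltxx.
  rewrite fromA; [|apply: ratioN; lra..].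
  rewrite subr0 (_ : _ / _ = (C - p) * (a * b / (C - S)) / C).
    by rewrite normE//; lra.
  by field; apply/and3P; split; lra.
(* Now [C] and [S] are positive: the origin is the lowest vertex, so the whole tent is seen, with
   its peak at the smaller of the two. *)
have w_ : width psi = support psi.
  by rewrite wE max_l ?addr0// ge_max; apply/andP; split; lra.
have [CS|CS] := leP C S.
- have P_ : support psi = S by rewrite PE (max_r CS) max_r// ltW.
  exists C; rewrite ?w_ P_; first lra.
  move=> p /andP[p0 pS]; split=> h.
    rewrite fromO; [|apply: ratio; lra..].
    rewrite (_ : _ / _ = p * (a * b / S) / C).
      by rewrite normE//; lra.
    by field; apply/andP; split; lra.
  rewrite fromB; [|apply: ratioN; lra..].
  rewrite (_ : _ / _ = (S - p) * (a * b / S) / (S - C)).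
    by rewrite normE//; lra.
  by field; rewrite ?oppr_eq0; apply/and3P; split; lra.
- have P_ : support psi = C by rewrite PE (max_l (ltW CS)) max_r// ltW.
  exists S; rewrite ?w_ P_; first lra.
  move=> p /andP[p0 pS]; split=> h.
    rewrite fromO; [|apply: ratio; lra..].
    rewrite (_ : _ / _ = p * (a * b / C) / S).
      by rewrite normE//; lra.
    by field; apply/andP; split; lra.
  rewrite fromA; [|apply: ratioN; lra..].
  rewrite (_ : _ / _ = (C - p) * (a * b / C) / (C - S)).
    by rewrite normE//; lra.
  by field; rewrite ?oppr_eq0; apply/and3P; split; lra.
Qed.

End RightTriangleChords.

(** * Measurability of the set of short chords and its measure by integration over directions *)

Section ShortChords.
Context {R : realType}.
Variables a b : R.
Implicit Types s p psi : R.
Hypotheses (a0 : 0 < a) (b0 : 0 < b).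
Local Notation T := (right_triangle a b).

Lemma continuous_support : continuous (support a b).
Proof.
move=> x.
apply: (@continuous_max R R (cst 0) (fun y => Num.max (a * cos y) (b * sin y))).
  exact: cvg_cst.
apply: (@continuous_max R R (fun y => a * cos y) (fun y => b * sin y)).
  by apply: cvgMr; exact: continuous_cos.
by apply: cvgMr; exact: continuous_sin.
Qed.

(** Joint measurability in [(p, psi, t)]; the chord length is the measure of a section in [t], hence
    measurable in [(p, psi)]. *)
Lemma measurable_line_pt_mem : measurable
  [set z : R * R * R | T (line_pt z.1.1 z.1.2 z.2)].
Proof.
have m1 : measurable_fun setT (fun z : R * R * R => z.1.1).
  exact: measurableT_comp.
have m2 : measurable_fun setT (fun z : R * R * R => z.1.2).
  exact: measurableT_comp.
have m3 : measurable_fun setT (fun z : R * R * R => z.2) by exact: measurable_snd.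
have mc : measurable_fun setT (fun z : R * R * R => cos z.1.2).
  apply: (measurableT_comp (f := @cos R)) => //.
  by apply: continuous_measurable_fun; exact: continuous_cos.
have ms : measurable_fun setT (fun z : R * R * R => sin z.1.2).
  apply: (measurableT_comp (f := @sin R)) => //.
  by apply: continuous_measurable_fun; exact: continuous_sin.
have mx : measurable_fun setT (fun z : R * R * R => (line_pt z.1.1 z.1.2 z.2).1).
  by apply: measurable_funB; apply: measurable_funM.
have my : measurable_fun setT (fun z : R * R * R => (line_pt z.1.1 z.1.2 z.2).2).
  by apply: measurable_funD; apply: measurable_funM.
rewrite right_triangleE//.
have -> : [set z : R * R * R | [set q : R * R | [/\ 0 <= q.1, 0 <= q.2 &
    b * q.1 + a * q.2 <= a * b]] (line_pt z.1.1 z.1.2 z.2)] =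
  [set z | 0 <= (line_pt z.1.1 z.1.2 z.2).1] `&`
  [set z | 0 <= (line_pt z.1.1 z.1.2 z.2).2] `&`
  [set z | b * (line_pt z.1.1 z.1.2 z.2).1 + a * (line_pt z.1.1 z.1.2 z.2).2
     <= a * b].
  by apply/seteqP; split => z /=; [move=> [? ? ?]|move=> [[]]].
have mle (f g : R * R * R -> R) : measurable_fun setT f ->
    measurable_fun setT g -> measurable [set z | f z <= g z].
  by move=> mf mg; rewrite -[X in measurable X]setTI; exact: measurable_fun_le.
apply: measurableI; first by apply: measurableI; apply: mle.
apply: mle => //; apply: measurable_funD; exact: measurable_funM.
Qed.

Lemma measurable_chord_length :
  measurable_fun setT (fun z : R * R => chord_length T z.1 z.2).
Proof.
have := measurable_fun_xsection (@lebesgue_measure R) measurable_line_pt_mem.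
congr (measurable_fun _ _); apply/funext => -[p psi] /=.
rewrite /chord_length chord_preimage; congr lebesgue_measure.
by apply/seteqP; split => t; rewrite /xsection/= inE.
Qed.

Definition short_chord s p psi : Prop :=
  chord T p psi !=set0 /\ (chord_length T p psi <= s%:E)%E.

(** By [chord_neq0], the existential condition that the chord is nonempty becomes an inequality
    between measurable functions. *)
Lemma measurable_short_chords s : measurable (line_params (short_chord s)).
Proof.
have -> : line_params (short_chord s) =
  [set z | 0 <= z.1] `&` [set z | 0 <= z.2] `&` [set z | z.2 < 2 * pi] `&`
  [set z | z.1 <= support a b z.2] `&`
  [set z | (chord_length T z.1 z.2 <= s%:E)%E].
  apply/seteqP; split => z /=.
    by move=> [z1 /andP[z2 z2'] [/(chord_neq0 a0 b0 _ z1)]].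
  move=> [[[[z1 z2] z2'] zs] zl]; split=> //; first by rewrite z2.
  by split=> //; apply/chord_neq0.
have mle (f g : R * R -> R) : measurable_fun setT f ->
    measurable_fun setT g -> measurable [set z | f z <= g z].
  by move=> mf mg; rewrite -[X in measurable X]setTI; exact: measurable_fun_le.
have msupp : measurable_fun setT (fun z : R * R => support a b z.2).
  apply: (measurableT_comp (f := support a b)) => //.
  by apply: continuous_measurable_fun; exact: continuous_support.
repeat apply: measurableI.
- exact: mle.
- exact: mle.
- rewrite (_ : [set z | _] = ~` [set z : R * R | 2 * pi <= z.2]).
    by apply: measurableC; exact: mle.
  by apply/seteqP; split => z /=; rewrite ltNge => /negP.
- exact: mle.
- rewrite -[X in measurable X]setTI; apply: measurable_lee => //.
  exact: measurable_chord_length.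
Qed.

(** For fixed [psi] the section is a sublevel set of the tent given by [chord_length_profile]. *)
Lemma ysection_short_chords s psi : 0 <= s -> 0 <= psi < 2 * pi ->
  lebesgue_measure (ysection (line_params (short_chord s)) psi) =
  (support a b psi * Num.min 1 (s * width a b psi / (a * b)))%:E.
Proof.
move=> s0 psi02.
have ab0 := mulr_gt0 a0 b0; have w0 := width_gt0 a0 b0 psi.
have [q q0P prof] := chord_length_profile a0 b0 psi.
have mem p : ysection (line_params (short_chord s)) psi p <->
    0 <= p /\ short_chord s p psi.
  by rewrite /ysection/= inE; split => [[]//|[]].
rewrite (@lebesgue_measure_tent _ _ (support a b psi) q (a * b / width a b psi) s)//.
- by congr ((_ * Num.min _ _)%:E); field; rewrite !gt_eqF.
- by rewrite divr_gt0.
- apply: measurable_ysection; exact: measurable_short_chords.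
- move=> p /mem[p0 [/(chord_neq0 a0 b0 _ p0) pP _]] /=.
  by rewrite in_itv/= p0.
- move=> p p0P pq; have [/(_ pq) cl _] := prof p p0P; have /andP[p0 pP] := p0P.
  rewrite -lee_fin -cl; split => [/mem[_ []]//|?].
  apply/mem; split; first exact: ltW.
  by split => //; apply/chord_neq0 => //; exact: ltW.
- move=> p p0P pq; have [_ /(_ pq) cl] := prof p p0P; have /andP[p0 pP] := p0P.
  rewrite -lee_fin -cl; split => [/mem[_ []]//|?].
  apply/mem; split; first exact: ltW.
  by split => //; apply/chord_neq0 => //; exact: ltW.
Qed.

(** Tonelli: by uniqueness of the product measure, [\x] may be replaced by [\x^], which integrates
    over [psi] the measure of the section in [p]. Sections outside [[0, 2 * pi[] are empty. *)
Lemma lines_measure_short_chords s : 0 <= s ->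
  lines_measure (short_chord s) =
  (\int[lebesgue_measure]_(psi in `[0%R, (2 * pi)%R[)
     (support a b psi * Num.min 1 (s * width a b psi / (a * b)))%:E)%E.
Proof.
move=> s0; have mD := measurable_short_chords s.
rewrite /lines_measure integral_cst// mul1e.
transitivity ((@lebesgue_measure R \x^ @lebesgue_measure R)%E
    (line_params (short_chord s))).
  apply: (@product_measure_unique _ _ _ _ _ lebesgue_measure lebesgue_measure
    (@lebesgue_measure R \x^ @lebesgue_measure R)%E) => // A B mA mB.
  by rewrite /= product_measure2E.
rewrite /= /product_measure2 [RHS]integral_mkcond; apply: eq_integral => psi _.
rewrite patchE; case: ifPn => /=.
  by rewrite inE/= in_itv/= => h; exact: ysection_short_chords.
rewrite notin_setE/= in_itv/= => psiN; apply/eqP.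
rewrite (_ : ysection _ _ = set0) ?measure0//.
by rewrite -subset0 => p; rewrite /ysection/= inE => -[].
Qed.

End ShortChords.

(** * Integration *)

Section ContinuousIntegrals.
Context {R : realType}.
Local Notation mu := (@lebesgue_measure R).
Implicit Types (f F : R -> R) (x y z d k r : R).

Lemma measurable_EFin_continuous (D : set R) f : continuous f ->
  measurable_fun D (fun t => (f t)%:E).
Proof.
move=> cf; apply/measurable_EFinP.
by apply: (measurable_funS measurableT) => //; exact: continuous_measurable_fun.
Qed.

Lemma ge0_integral_itvD f x y z : continuous f ->
  (forall t, x <= t <= z -> 0 <= f t) -> x <= y -> y <= z ->
  (\int[mu]_(t in `[x, z]) (f t)%:E =
   \int[mu]_(t in `[x, y]) (f t)%:E + \int[mu]_(t in `[y, z]) (f t)%:E)%E.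
Proof.
move=> cf f0 xy yz; have mf D := @measurable_EFin_continuous D f cf.
rewrite (@itv_bndbnd_setU _ _ _ (BRight y)) ?bnd_simp//.
rewrite ge0_integral_setU//=.
- by congr (_ + _)%E; rewrite integral_itv_obnd_cbnd.
- exact: mf.
- move=> t; rewrite /= !in_itv/= lee_fin => tz; apply: f0.
  by case: tz => /andP[xt tz]; apply/andP; split; lra.
- apply/disj_setPS => t [] /=; rewrite !in_itv/= => /andP[_ ty] /andP[yt _].
  by move: (lt_le_trans yt ty); rewrite ltxx.
Qed.

Lemma integral_itv_shift f x y d : continuous f -> x <= y ->
  (\int[mu]_(t in `[(x + d)%R, (y + d)%R]) (f t)%:E =
   \int[mu]_(t in `[x, y]) (f (t + d))%:E)%E.
Proof.
move=> cf xy.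
have dF : derive1 (fun t => t + d) = cst 1.
  by apply/funext => t; rewrite derive1E derive_val addr0.
have cF : continuous (fun t => t + d).
  by move=> t; apply: cvgD; [exact: cvg_id|exact: cvg_cst].
rewrite (@integration_by_substitution_increasing _ (fun t => t + d))//.
- by apply: eq_integral => t _ /=; rewrite dF /= mulr1.
- by move=> u v _ _; rewrite ltrD2r.
- by rewrite dF => ? _; exact: cvg_cst.
- by rewrite dF; exact: is_cvg_cst.
- by rewrite dF; exact: is_cvg_cst.
- split; first by move=> t _; apply: derivableD.
  + by apply: cvg_at_right_filter; exact: cF.
  + by apply: cvg_at_left_filter; exact: cF.
- exact: continuous_subspaceT.
Qed.

Lemma integral_itv_reflect f x y d : continuous f -> x <= y ->
  (\int[mu]_(t in `[(d - y)%R, (d - x)%R]) (f t)%:E =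
   \int[mu]_(t in `[x, y]) (f (d - t))%:E)%E.
Proof.
move=> cf xy; rewrite ![d - _]addrC integral_itv_shift ?lerN2//.
have cfd : continuous (fun t => f (t + d)).
  move=> t; apply: (@continuous_comp _ _ _ (fun t => t + d) f); last exact: cf.
  by apply: cvgD; [exact: cvg_id|exact: cvg_cst].
rewrite (integration_by_substitution_oppr (G := fun t => f (t + d)))//.
  by apply: eq_integral => t _ /=; rewrite addrC.
exact: continuous_subspaceT.
Qed.

Lemma integral_itv_derive f F x y : continuous f ->
  (forall t : R, is_derive t 1 F (f t)) -> x <= y ->
  (\int[mu]_(t in `[x, y]) (f t)%:E = (F y - F x)%:E)%E.
Proof.
move=> cf dF; rewrite le_eqVlt => /predU1P[->|xy].
  by rewrite set_itv1 integral_set1 subrr.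
have cF : continuous F.
  by move=> t; apply/differentiable_continuous/derivable1_diffP; have [] := dF t.
rewrite (continuous_FTC2 xy (continuous_subspaceT cf) (F := F)) ?EFinB//.
- split; first by move=> t _; have [] := dF t.
  + by apply: cvg_at_right_filter; exact: cF.
  + by apply: cvg_at_left_filter; exact: cF.
- by move=> t _; have [_ <-] := dF t; rewrite derive1E.
Qed.

End ContinuousIntegrals.

(** * Integrals of the capped cosine *)

Section CappedCosine.
Context {R : realType}.
Local Notation mu := (@lebesgue_measure R).
Implicit Types (beta x y k r : R).

(* [cap k w] is the measure of the chords of length at most [s] in a fixed
   direction in which the triangle has width [w], for [k = s / (a * b)]. *)
Definition cap k w : R := w * Num.min 1 (k * w).

Lemma continuous_cap k : continuous (cap k).
Proof.
move=> x; apply: cvgM; first exact: cvg_id.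
apply: (@continuous_min R R (cst 1) (fun w => k * w)); first exact: cvg_cst.
by apply: cvgMr; exact: cvg_id.
Qed.

Lemma cap_ge0 k w : 0 <= k -> 0 <= w -> 0 <= cap k w.
Proof. by move=> k0 w0; rewrite mulr_ge0// le_min ler01 mulr_ge0. Qed.

Lemma continuous_cos_scale r : continuous (fun t : R => r * cos t).
Proof. by move=> t; apply: cvgMr; exact: continuous_cos. Qed.

Lemma continuous_cap_cos k r : continuous (fun t : R => cap k (r * cos t)).
Proof.
move=> t; apply: (@continuous_comp _ _ _ (fun t : R => r * cos t) (cap k)).
  exact: continuous_cos_scale.
exact: continuous_cap.
Qed.

Lemma integral_cos r x y : x <= y ->
  (\int[mu]_(t in `[x, y]) (r * cos t)%:E = (r * sin y - r * sin x)%:E)%E.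
Proof.
move=> xy; apply: (@integral_itv_derive _ _ (fun t => r * sin t)) => //.
exact: continuous_cos_scale.
Qed.

Lemma integral_sqr_cos r x y : x <= y ->
  (\int[mu]_(t in `[x, y]) (r * cos t ^+ 2)%:E =
   (r / 2 * (y + sin y * cos y) - r / 2 * (x + sin x * cos x))%:E)%E.
Proof.
move=> xy.
apply: (@integral_itv_derive _ _ (fun t => r / 2 * (t + sin t * cos t))) => //.
  move=> t; apply: cvgMr.
  apply: (@continuous_comp _ _ _ (@cos R) (fun w : R => w ^+ 2)).
    exact: continuous_cos.
  exact: exprn_continuous.
move=> t; apply: is_derive_eq.
by rewrite /GRing.scale/= mulrN -expr2 sin2cos2 -expr2; field.
Qed.

Lemma ler_cos_pi x y : 0 <= x -> x <= y -> y <= pi -> cos y <= cos x.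
Proof.
move=> x0 xy ypi; rewrite leNgt; apply/negP.
rewrite ltr_cos ?in_itv/= ?x0 ?ypi ?(le_trans x0) ?(le_trans xy)//.
by move=> /(le_lt_trans xy); rewrite ltxx.
Qed.

(** As [k * r * cos t] never exceeds 1, the integrand is quadratic in the cosine throughout. *)
Lemma integral_cap_cos_small k r beta : 0 <= k -> 0 <= r -> k * r <= 1 ->
  0 <= beta ->
  (\int[mu]_(t in `[0%R, beta]) (cap k (r * cos t))%:E =
   (k * r ^+ 2 / 2 * (beta + sin beta * cos beta))%:E)%E.
Proof.
move=> k0 r0 kr b0.
transitivity (\int[mu]_(t in `[0%R, beta]) (k * r ^+ 2 * cos t ^+ 2)%:E)%E.
  apply: eq_integral => t _; congr _%:E; rewrite /cap min_r; first ring.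
  rewrite mulrA; apply: (le_trans _ kr).
  by rewrite ler_piMr ?cos_le1// mulr_ge0.
by rewrite integral_sqr_cos// sin0 mul0r addr0 mulr0 subr0.
Qed.

(** The cosine decreases, so the condition at [beta] makes the minimum equal to 1 on the whole
    interval. *)
Lemma integral_cap_cos_large k r beta : 0 <= k -> 0 <= r ->
  1 <= k * (r * cos beta) -> 0 <= beta -> beta <= pi / 2 ->
  (\int[mu]_(t in `[0%R, beta]) (cap k (r * cos t))%:E = (r * sin beta)%:E)%E.
Proof.
move=> k0 r0 kr b0 bpi; have pi0 := @pi_gt0 R.
transitivity (\int[mu]_(t in `[0%R, beta]) (r * cos t)%:E)%E.
  apply: eq_integral => t; rewrite inE/= in_itv/= => /andP[t0 tb].
  congr _%:E; rewrite /cap min_l ?mulr1//; apply: (le_trans kr).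
  by rewrite !ler_wpM2l// ler_cos_pi//; lra.
by rewrite integral_cos// sin0 mulr0 subr0.
Qed.

(** The minimum changes branch at the angle [phi] with [k * r * cos phi = 1], which lies between 0
    and [beta]: the integrand is linear in the cosine before [phi] and quadratic after it. *)
Lemma integral_cap_cos k r beta : 0 < k -> 0 < r ->
  1 <= k * r -> k * (r * cos beta) <= 1 -> 0 <= beta -> beta <= pi / 2 ->
  (\int[mu]_(t in `[0%R, beta]) (cap k (r * cos t))%:E =
   (r * Num.sqrt (1 - (k * r)^-1 ^+ 2) / 2 + k * r ^+ 2 / 2 *
     (beta - pi / 2 + asin (k * r)^-1 + sin beta * cos beta))%:E)%E.
Proof.
move=> k0 r0 kr krb b0 bpi; have pi0 := @pi_gt0 R.
have kr0 : 0 < k * r by rewrite mulr_gt0.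
set v := (k * r)^-1; pose phi := pi / 2 - asin v.
have krv : k * r * v = 1 by rewrite mulfV// gt_eqF.
have v0 : 0 < v by rewrite invr_gt0.
have v1 : v <= 1 by rewrite invf_le1.
have v11 : -1 <= v <= 1 by lra.
have cphi : cos phi = v.
  by rewrite /phi cosB cos_pihalf sin_pihalf mul0r add0r mul1r asinK.
have sphi : sin phi = Num.sqrt (1 - v ^+ 2).
  rewrite /phi sinB cos_pihalf sin_pihalf mul1r mul0r subr0.
  exact: cos_asin.
have phi0 : 0 <= phi by rewrite subr_ge0 asin_lepi2.
have phipi : phi <= pi by have := asin_geNpi2 v11; rewrite /phi; lra.
have phib : phi <= beta.
  rewrite leNgt; apply/negP => bphi.
  have : cos phi < cos beta.
    by rewrite ltr_cos// in_itv/= ?phi0 ?phipi ?b0//; lra.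
  by rewrite cphi -(ltr_pM2l kr0) krv -mulrA => /lt_le_trans/(_ krb); rewrite ltxx.
rewrite (ge0_integral_itvD (y := phi))//; last 2 first.
- exact: continuous_cap_cos.
- move=> t tb; apply: cap_ge0; first exact: ltW.
  by apply: mulr_ge0; [exact: ltW|apply: cos_ge0_pihalf; lra].
have krphi : 1 <= k * (r * cos phi) by rewrite cphi mulrA krv.
rewrite (integral_cap_cos_large (ltW k0) (ltW r0) krphi phi0 (le_trans phib bpi)).
have -> : (\int[mu]_(t in `[phi, beta]) (cap k (r * cos t))%:E =
    \int[mu]_(t in `[phi, beta]) (k * r ^+ 2 * cos t ^+ 2)%:E)%E.
  apply: eq_integral => t; rewrite inE/= in_itv/= => /andP[t0 tb].
  congr _%:E; rewrite /cap min_r; first ring.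
  rewrite mulrA -krv ler_pM2l// -cphi ler_cos_pi//; lra.
rewrite integral_sqr_cos// -EFinD sphi cphi; congr _%:E.
(* Hence the boundary term of the quadratic part at [phi] cancels half of [r * sin phi]. *)
have krE : k * r ^+ 2 * v = r by rewrite expr2 mulrA mulrAC krv mul1r.
apply/eqP; rewrite -subr_eq0; apply/eqP.
set S := Num.sqrt _; transitivity ((r - k * r ^+ 2 * v) * S / 2).
  by rewrite /phi; field.
by rewrite krE subrr !mul0r.
Qed.

End CappedCosine.

(** * The distribution function *)

Section Assembly.
Context {R : realType}.
Variables a b : R.
Hypotheses (a0 : 0 < a) (b0 : 0 < b).
Local Notation mu := (@lebesgue_measure R).
Local Notation alpha := (angle_alpha a b).
Local Notation c := (hyp_c a b).
Local Notation h := (height_h a b).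
Implicit Types k r s t x psi beta : R.

Lemma hyp_c_gt0 : 0 < c.
Proof. by rewrite sqrtr_gt0 addr_gt0 ?exprn_gt0. Qed.

Lemma sqr_hyp_c : c ^+ 2 = a ^+ 2 + b ^+ 2.
Proof. by rewrite sqr_sqrtr// addr_ge0 ?sqr_ge0. Qed.

Lemma alpha_bounds : 0 <= alpha /\ alpha <= pi / 2.
Proof.
split; last exact/ltW/atan_ltpi2.
by rewrite -(@atan0 R); apply: le_atan; rewrite divr_ge0// ltW.
Qed.

Lemma cos_alpha : cos alpha = b / c.
Proof.
rewrite cos_atan (_ : 1 + (a / b) ^+ 2 = c ^+ 2 / b ^+ 2); last first.
  by rewrite sqr_hyp_c; field; rewrite gt_eqF.
rewrite -exprVn -exprMn sqrtr_sqr gtr0_norm ?invf_div//.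
by rewrite divr_gt0// hyp_c_gt0.
Qed.

Lemma sin_alpha : sin alpha = a / c.
Proof.
have ca0 : cos alpha != 0.
  by rewrite cos_alpha mulf_neq0 ?invr_eq0 ?gt_eqF// hyp_c_gt0.
have := atanK (a / b); rewrite -/alpha /tan => /(congr1 ( *%R ^~ (cos alpha))).
rewrite divfK// => ->; rewrite cos_alpha; field.
by rewrite !gt_eqF// hyp_c_gt0.
Qed.

(** The difference of the levels of [(0, b)] and [(a, 0)]; its sign decides which of the two is
    farther. *)
Lemma hyp_sinB psi : c * sin (psi - alpha) = b * sin psi - a * cos psi.
Proof.
rewrite sinB cos_alpha sin_alpha; field.
by rewrite gt_eqF// hyp_c_gt0.
Qed.

Lemma support_periodic psi : support a b (psi + pi + pi) = support a b psi.
Proof. by rewrite /support !cosDpi !sinDpi !opprK. Qed.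

Lemma width_periodic psi : width a b (psi + pi) = width a b psi.
Proof. by rewrite /width support_periodic addrC. Qed.

Lemma widthE psi : width a b psi =
  Num.max 0 (Num.max (a * cos psi) (b * sin psi)) +
  Num.max 0 (Num.max (- (a * cos psi)) (- (b * sin psi))).
Proof. by rewrite /width {2}/support cosDpi sinDpi !mulrN. Qed.

(** Both legs project to nonnegative levels, so the origin is the lowest vertex. *)
Lemma width_first psi : 0 <= psi <= pi / 2 ->
  width a b psi = Num.max (a * cos psi) (b * sin psi).
Proof.
move=> psi02; have pi0 := @pi_gt0 R.
have C0 : 0 <= a * cos psi.
  by apply: mulr_ge0; [exact: ltW|apply: cos_ge0_pihalf; lra].
have S0 : 0 <= b * sin psi.
  by apply: mulr_ge0; [exact: ltW|apply: sin_ge0_pi; lra].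
rewrite widthE max_r ?le_max ?C0// [X in _ + X]max_l ?addr0//.
by rewrite ge_max !oppr_le0 C0.
Qed.

(** The origin lies between the other two vertices, so the width is the projected hypotenuse. *)
Lemma width_second psi : pi / 2 <= psi <= pi ->
  width a b psi = c * sin (psi - alpha).
Proof.
move=> psi02; have pi0 := @pi_gt0 R.
have C0 : a * cos psi <= 0.
  rewrite -(subrK (pi / 2) psi) cosDpihalf mulrN oppr_le0.
  by apply: mulr_ge0; [exact: ltW|apply: sin_ge0_pi; lra].
have S0 : 0 <= b * sin psi.
  by apply: mulr_ge0; [exact: ltW|apply: sin_ge0_pi; lra].
rewrite widthE hyp_sinB [X in Num.max 0 X + _]max_r ?(le_trans C0)//.
by rewrite [X in _ + Num.max 0 X]max_l ?lerN2 ?(le_trans C0)// !max_r// oppr_ge0.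
Qed.

Lemma continuous_width : continuous (width a b).
Proof.
move=> x; apply: cvgD; first exact: continuous_support.
apply: (@continuous_comp _ _ _ (fun t : R => t + pi) (support a b)).
  by apply: cvgD; [exact: cvg_id|exact: cvg_cst].
exact: continuous_support.
Qed.

(** Folding [[pi, 2 * pi]] onto [[0, pi]] adds the supports of opposite directions, which share the
    width and thus the factor [Num.min]. *)
Lemma lines_measure_cap s : 0 <= s ->
  lines_measure (short_chord a b s) =
  (\int[mu]_(t in `[0%R, pi]) (cap (s / (a * b)) (width a b t))%:E)%E.
Proof.
move=> s0; have pi0 := @pi_gt0 R; have ab0 := mulr_gt0 a0 b0.
have k0 : 0 <= s / (a * b) by rewrite divr_ge0// ltW.
rewrite lines_measure_short_chords//.
pose F t := support a b t * Num.min 1 (s / (a * b) * width a b t).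
have cF : continuous F.
  move=> x; apply: cvgM; first exact: continuous_support.
  apply: (@continuous_min R R (cst 1) (fun t => s / (a * b) * width a b t)).
    exact: cvg_cst.
  by apply: cvgMr; exact: continuous_width.
have F0 t : 0 <= F t.
  by rewrite mulr_ge0 ?support_ge0// le_min ler01 mulr_ge0// ltW// width_gt0.
have mF D := @measurable_EFin_continuous _ D F cF.
transitivity (\int[mu]_(t in `[0%R, (2 * pi)%R[) (F t)%:E)%E.
  by apply: eq_integral => t _; rewrite /F mulrAC.
rewrite integral_itv_bndo_bndc// (@ge0_integral_itvD _ _ _ pi)//; [|lra..].
have -> : `[pi, 2 * pi]%classic = `[0 + pi, pi + pi]%classic :> set R.
  by rewrite add0r mulr_natl mulr2n.
rewrite integral_itv_shift ?ltW// -ge0_integralD//=.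
- apply: eq_integral => t _; rewrite -EFinD /F width_periodic -mulrDl.
  by rewrite /cap /width.
- by move=> t _; rewrite lee_fin.
- exact: mF.
- by move=> t _; rewrite lee_fin.
- apply: (@measurable_EFin_continuous _ _ (fun t => F (t + pi))) => x.
  apply: (@continuous_comp _ _ _ (fun t : R => t + pi) F); last exact: cF.
  by apply: cvgD; [exact: cvg_id|exact: cvg_cst].
Qed.

(** The range is cut at [alpha], where the two legs project equally, at [pi / 2], and at
    [pi / 2 + alpha], where the hypotenuse projects to its full length. Reflections and a shift turn
    the sines on the last three pieces into cosines on intervals starting at 0. *)
Lemma lines_measure_cap_cos s : 0 <= s ->
  let J r beta :=
    (\int[mu]_(t in `[0%R, beta]) (cap (s / (a * b)) (r * cos t))%:E)%E in
  lines_measure (short_chord a b s) =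
  (J a alpha + J b (pi / 2 - alpha)%R +
   (J c alpha + J c (pi / 2 - alpha)%R))%E.
Proof.
move=> s0 J; rewrite lines_measure_cap// /J; set k := s / (a * b).
have pi0 := @pi_gt0 R; have [al0 al2] := alpha_bounds.
have k0 : 0 <= k by rewrite divr_ge0// mulr_ge0// ltW.
have cW : continuous (fun t => cap k (width a b t)).
  move=> x; apply: (@continuous_comp _ _ _ (width a b) (cap k)).
    exact: continuous_width.
  exact: continuous_cap.
have W0 t : 0 <= cap k (width a b t) by rewrite cap_ge0// ltW// width_gt0.
rewrite (@ge0_integral_itvD _ _ _ (pi / 2))//; [|lra..].
rewrite (@ge0_integral_itvD _ _ _ alpha (pi / 2))//.
rewrite (@ge0_integral_itvD _ _ _ (pi / 2 + alpha) pi)//; [|lra..].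
congr ((_ + _) + (_ + _))%E.
- apply: eq_integral => t; rewrite inE/= in_itv/= => /andP[t0 ta].
  rewrite width_first; last lra.
  rewrite max_l// -subr_le0 -hyp_sinB -opprB sinN mulrN oppr_le0.
  by rewrite mulr_ge0 ?(ltW hyp_c_gt0) ?sin_ge0_pi//; lra.
- have -> : `[alpha, pi / 2]%classic =
      `[pi / 2 - (pi / 2 - alpha), pi / 2 - 0]%classic :> set R.
    by rewrite subr0 subKr.
  rewrite integral_itv_reflect//; last lra.
  apply: eq_integral => t; rewrite inE/= in_itv/= => /andP[t0 ta].
  rewrite width_first; last lra.
  rewrite max_r.
    by rewrite sinB sin_pihalf cos_pihalf mul1r mul0r subr0.
  rewrite -subr_ge0 -hyp_sinB.
  by rewrite mulr_ge0 ?(ltW hyp_c_gt0) ?sin_ge0_pi//; lra.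
- have -> : `[pi / 2, pi / 2 + alpha]%classic =
      `[pi / 2 + alpha - alpha, pi / 2 + alpha - 0]%classic :> set R.
    by rewrite subr0 addrK.
  rewrite integral_itv_reflect//.
  apply: eq_integral => t; rewrite inE/= in_itv/= => /andP[t0 ta].
  rewrite width_second; last lra.
  rewrite (_ : _ - alpha = - t + pi / 2); last by ring.
  by rewrite sinDpihalf cosN.
- have -> : `[pi / 2 + alpha, pi]%classic =
      `[0 + (pi / 2 + alpha), pi / 2 - alpha + (pi / 2 + alpha)]%classic :> set R.
    by rewrite add0r (_ : pi / 2 - alpha + _ = pi)//; field.
  rewrite integral_itv_shift//; last lra.
  apply: eq_integral => t; rewrite inE/= in_itv/= => /andP[t0 ta].
  rewrite width_second; last lra.
  rewrite (_ : _ - alpha = t + pi / 2); last by ring.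
  by rewrite sinDpihalf.
Qed.

Lemma height_hE : h = a * b / c.
Proof. by rewrite /height_h cos_alpha mulrA. Qed.

(** For [s >= c] the left side is what the two leg integrals contribute. *)
Lemma hyp_sum : a * sin alpha + b * cos alpha = c.
Proof.
have c0 := hyp_c_gt0; rewrite sin_alpha cos_alpha !mulrA -mulrDl -!expr2.
by rewrite -sqr_hyp_c expr2 mulfK// gt_eqF.
Qed.

(* The three regimes of [integral_cap_cos] for the side [r] with altitude [x],
   where [r * x = a * b] is twice the area. *)
Lemma side_small r x beta s : 0 < r -> 0 < x -> r * x = a * b ->
  0 <= s <= x -> 0 <= beta ->
  (\int[mu]_(t in `[0%R, beta]) (cap (s / (a * b)) (r * cos t))%:E =
   (r / (2 * x) * s * (beta + sin beta * cos beta))%:E)%E.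
Proof.
move=> r0 x0 <- /andP[s0 sx] be0; have rx0 := mulr_gt0 r0 x0.
rewrite integral_cap_cos_small//.
- by congr _%:E; field; rewrite !gt_eqF.
- by rewrite divr_ge0// ltW.
- exact: ltW.
- by rewrite mulrAC ler_pdivrMr// mul1r mulrC ler_pM2l.
Qed.

Lemma side_large r x beta s : 0 < r -> 0 < x -> r * x = a * b ->
  0 <= s -> x <= s * cos beta -> 0 <= beta -> beta <= pi / 2 ->
  (\int[mu]_(t in `[0%R, beta]) (cap (s / (a * b)) (r * cos t))%:E =
   (r * sin beta)%:E)%E.
Proof.
move=> r0 x0 <- s0 sx be0 be2; have rx0 := mulr_gt0 r0 x0.
rewrite integral_cap_cos_large//.
- by rewrite divr_ge0// ltW.
- exact: ltW.
- by rewrite mulrAC ler_pdivlMr// mul1r mulrCA ler_pM2l.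
Qed.

Lemma side_middle r x beta s : 0 < r -> 0 < x -> r * x = a * b ->
  x <= s -> s * cos beta <= x -> 0 <= beta -> beta <= pi / 2 ->
  (\int[mu]_(t in `[0%R, beta]) (cap (s / (a * b)) (r * cos t))%:E =
   (r / 2 * L2 s x + r / (2 * x) *
      (L1 s x + s * (beta - pi / 2 + sin beta * cos beta)))%:E)%E.
Proof.
move=> r0 x0 <- xs sx be0 be2; have rx0 := mulr_gt0 r0 x0.
have s0 : 0 < s by apply: lt_le_trans xs.
rewrite integral_cap_cos//.
- have -> : (s / (r * x) * r)^-1 = x / s by field; rewrite !gt_eqF.
  by congr _%:E; rewrite /L1 /L2; field; rewrite !gt_eqF.
- exact: divr_gt0.
- by rewrite mulrAC ler_pdivlMr// mul1r mulrC ler_pM2r.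
- by rewrite mulrAC ler_pdivrMr// mul1r mulrCA ler_pM2l.
Qed.

Lemma chord_cdf_lt0 s : s < 0 -> chord_cdf a b s = 0%:E.
Proof.
move=> s0; rewrite /chord_cdf /lines_measure.
rewrite (_ : line_params _ = set0) ?integral_set0 ?mule0//.
rewrite -subset0 => z [_ _ [_ zs]].
have : (0 <= s%:E)%E by apply: (le_trans _ zs); exact: measure_ge0.
by rewrite lee_fin leNgt s0.
Qed.

Lemma chord_cdf_eq s v : lines_measure (short_chord a b s) = v%:E ->
  chord_cdf a b s = (v / perimeter_u a b)%:E.
Proof. by move=> E; rewrite [LHS]/(_ * _)%E -/(short_chord a b s) E mulrC. Qed.

Lemma cos_beta : cos (pi / 2 - alpha) = a / c.
Proof. by rewrite cosB cos_pihalf sin_pihalf mul0r add0r mul1r sin_alpha. Qed.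

Lemma sin_beta : sin (pi / 2 - alpha) = b / c.
Proof. by rewrite sinB cos_pihalf sin_pihalf mul0r subr0 mul1r cos_alpha. Qed.

Lemma sqr_hyp_c_neq0 : a ^+ 2 + b ^+ 2 != 0.
Proof. by rewrite gt_eqF// addr_gt0 ?exprn_gt0. Qed.

Lemma sin_cos_alpha : a / c * (b / c) = a * b / (a ^+ 2 + b ^+ 2).
Proof. by rewrite -sqr_hyp_c; field; rewrite gt_eqF// hyp_c_gt0. Qed.

Lemma hyp_c_height : c / (2 * h) = (a ^+ 2 + b ^+ 2) / (2 * (a * b)).
Proof.
by rewrite height_hE -sqr_hyp_c; field; rewrite !gt_eqF// hyp_c_gt0.
Qed.

(** The altitudes over [a], [b], [c] are [b], [a], [h]. Each of the four integrals passes from the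
    small to the middle regime when [s] reaches the altitude. It becomes large at [s = c] for both
    legs, and for the hypotenuse at [s = a] over [[0, alpha]] and at [s = b] over
    [[0, pi / 2 - alpha]]. These thresholds give the five ranges of [s]. *)
Lemma chord_cdf_cases s : a <= b ->
  (0 <= s < h -> chord_cdf a b s = (H1 a b s / perimeter_u a b)%:E) /\
  (h <= s < a -> chord_cdf a b s = (H2 a b s / perimeter_u a b)%:E) /\
  (a <= s < b -> chord_cdf a b s = (H3 a b s / perimeter_u a b)%:E) /\
  (b <= s < c -> chord_cdf a b s = (H4 a b s / perimeter_u a b)%:E) /\
  (c <= s -> chord_cdf a b s = 1%:E).
Proof.
move=> ab; have c0 := hyp_c_gt0; have [al0 al2] := alpha_bounds.
have be0 : 0 <= pi / 2 - alpha by rewrite subr_ge0.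
have be2 : pi / 2 - alpha <= pi / 2 by rewrite gerBl.
have h0 : 0 < h by rewrite height_hE divr_gt0// mulr_gt0.
have ch : c * h = a * b by rewrite height_hE mulrC divfK// gt_eqF.
have ba := mulrC b a.
have ac : a <= c.
  by rewrite -ler_sqr ?nnegrE ?(ltW a0) ?(ltW c0)// sqr_hyp_c lerDl sqr_ge0.
have bc : b <= c.
  by rewrite -ler_sqr ?nnegrE ?(ltW b0) ?(ltW c0)// sqr_hyp_c lerDr sqr_ge0.
have ha : h <= a by rewrite height_hE ler_pdivrMr// ler_pM2l.
have hb : h <= b := le_trans ha ab.
(* These four equivalences turn the regime conditions at the upper limit of integration into
   comparisons of [s] with [a], [b] or [c]. *)
have scos_alpha_le x : (s * cos alpha <= x) = (s * b <= x * c).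
  by rewrite cos_alpha mulrA ler_pdivrMr.
have scos_beta_le x : (s * cos (pi / 2 - alpha) <= x) = (s * a <= x * c).
  by rewrite cos_beta mulrA ler_pdivrMr.
have scos_alpha_ge x : (x <= s * cos alpha) = (x * c <= s * b).
  by rewrite cos_alpha mulrA ler_pdivlMr.
have scos_beta_ge x : (x <= s * cos (pi / 2 - alpha)) = (x * c <= s * a).
  by rewrite cos_beta mulrA ler_pdivlMr.
have hc : h * c = a * b by rewrite mulrC.
pose trig := (cos_alpha, sin_alpha, cos_beta, sin_beta).
do 4?[split].
- move=> /andP[s0 sh]; apply: chord_cdf_eq; rewrite lines_measure_cap_cos//=.
  have [s_h s_a s_b] : [/\ 0 <= s <= h, 0 <= s <= a & 0 <= s <= b].
    by split; lra.
  rewrite (side_small a0 b0)// (side_small b0 a0)// !(side_small c0 h0)//.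
  rewrite -!EFinD !trig [b / c * (a / c)]mulrC sin_cos_alpha hyp_c_height.
  by congr _%:E; rewrite /H1 /Theta1; field; rewrite sqr_hyp_c_neq0 !gt_eqF.
- move=> /andP[hs sa]; apply: chord_cdf_eq.
  have s0 : 0 <= s by lra.
  rewrite lines_measure_cap_cos//=.
  have [s_a s_b] : 0 <= s <= a /\ 0 <= s <= b by split; lra.
  rewrite (side_small a0 b0)// (side_small b0 a0)//.
  rewrite !(side_middle c0 h0)//; last 2 first.
  - by rewrite scos_beta_le hc mulrC ler_pM2l//; lra.
  - by rewrite scos_alpha_le hc ler_pM2r//; lra.
  rewrite -!EFinD !trig [b / c * (a / c)]mulrC sin_cos_alpha hyp_c_height.
  by congr _%:E; rewrite /H2 /Theta2 /Theta3; field; rewrite sqr_hyp_c_neq0 !gt_eqF.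
- move=> /andP[as_ sb]; apply: chord_cdf_eq.
  have s0 : 0 <= s by lra.
  rewrite lines_measure_cap_cos//=.
  have [s_b hs] : 0 <= s <= b /\ h <= s by split; lra.
  rewrite (side_small a0 b0)// (side_middle b0 a0)//; last first.
    by rewrite scos_beta_le mulrC ler_pM2l//; lra.
  rewrite (side_large c0 h0)//; last first.
    by rewrite scos_alpha_ge hc ler_pM2r.
  rewrite (side_middle c0 h0)//; last first.
    by rewrite scos_beta_le hc mulrC ler_pM2l//; lra.
  rewrite -!EFinD !trig [b / c * (a / c)]mulrC sin_cos_alpha hyp_c_height.
  have -> : c * (a / c) = a by rewrite mulrC divfK// gt_eqF.
  by congr _%:E; rewrite /H3 /Theta4 /Theta3; field; rewrite sqr_hyp_c_neq0 !gt_eqF.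
- move=> /andP[bs sc]; apply: chord_cdf_eq.
  have s0 : 0 <= s by lra.
  rewrite lines_measure_cap_cos//=.
  have as_ : a <= s by lra.
  rewrite (side_middle a0 b0)//; last first.
    by rewrite scos_alpha_le mulrC ler_pM2l//; lra.
  rewrite (side_middle b0 a0)//; last first.
    by rewrite scos_beta_le mulrC ler_pM2l//; lra.
  rewrite !(side_large c0 h0)//; last 2 first.
  - by rewrite scos_beta_ge hc mulrC ler_pM2r.
  - by rewrite scos_alpha_ge hc ler_pM2r.
  rewrite -!EFinD !trig [b / c * (a / c)]mulrC sin_cos_alpha.
  have -> : c * (a / c) = a by rewrite mulrC divfK// gt_eqF.
  have -> : c * (b / c) = b by rewrite mulrC divfK// gt_eqF.
  by congr _%:E; rewrite /H4 /Theta5 /Theta6; field; rewrite sqr_hyp_c_neq0 !gt_eqF.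
- move=> cs; have u0 : perimeter_u a b != 0.
    by rewrite gt_eqF// !addr_gt0.
  rewrite -(divff u0); apply: chord_cdf_eq.
  have s0 : 0 <= s by lra.
  rewrite lines_measure_cap_cos//=.
  have [as_ bs] : a <= s /\ b <= s by split; lra.
  rewrite (side_large a0 b0)//; last first.
    by rewrite scos_alpha_ge mulrC ler_pM2r.
  rewrite (side_large b0 a0)//; last first.
    by rewrite scos_beta_ge mulrC ler_pM2r.
  rewrite !(side_large c0 h0)//; last 2 first.
  - by rewrite scos_beta_ge hc mulrC ler_pM2r.
  - by rewrite scos_alpha_ge hc ler_pM2r.
  rewrite -!EFinD sin_beta -cos_alpha hyp_sum cos_alpha sin_alpha.
  have -> : c * (a / c) = a by rewrite mulrC divfK// gt_eqF.
  have -> : c * (b / c) = b by rewrite mulrC divfK// gt_eqF.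
  congr _%:E; exact: addrC.
Qed.

End Assembly.

Theorem theorem1 (R : realType) (a b : R) (ha : 0 < a) (hab : a <= b) (s : R) :
  let c := hyp_c a b in
  let h := height_h a b in
  let u := perimeter_u a b in
  (s < 0 -> chord_cdf a b s = 0%:E) /\
  (0 <= s < h -> chord_cdf a b s = (H1 a b s / u)%:E) /\
  (h <= s < a -> chord_cdf a b s = (H2 a b s / u)%:E) /\
  (a <= s < b -> chord_cdf a b s = (H3 a b s / u)%:E) /\
  (b <= s < c -> chord_cdf a b s = (H4 a b s / u)%:E) /\
  (c <= s -> chord_cdf a b s = 1%:E).
Proof.
have hb := lt_le_trans ha hab.
move=> c h u; split; first exact: chord_cdf_lt0.
exact: chord_cdf_cases.
Qed.
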